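(* Let $g=\sum_{i=1}^{n-2}(\mathrm{d}x^i)^2+2\,\mathrm{d}u\,(\mathrm{d}r+h\,\mathrm{d}u)$, with $h=h(x^1,\dots,x^{n-2},u)$ real analytic, be a $pp$-wave of odd dimension $n$, or of even dimension $n=2s$ with $\Delta^s h=0$, where $\Delta=\sum_{i=1}^{n-2}\partial_i^2$. Let $G$ be the holonomy group of the ambient metric of this $pp$-wave. Then $G$ is contained in the stabiliser in $\mathrm{SO}(2,n)$ of a totally null plane in $\mathbb R^{2,n}$.
   Context: The ambient metric of the $pp$-wave $g$ is the Ricci-flat metric $$\widetilde g=2\,\mathrm d(t\rho)\,\mathrm dt+t^2\left(g+\Big(\sum_{k\ge1}\frac{\Delta^kh}{k!\,p_k}\rho^k\Big)\mathrm du^2\right),\qquad p_k=\prod_{j=1}^k(2j-n),$$ of signature $(2,n)$, defined for $\rho$ near $0$ and $t$ near $1$ (coordinates $\rho,x^1,\dots,x^{n-2},u,r,t$); for $n=2s$ even with $\Delta^sh=0$ the sum runs only over $1\le k\le s-1$. The holonomy group is that of the Levi-Civita connection of $\widetilde g$. A totally null plane is a $2$-dimensional subspace on which the scalar product vanishes identically. *)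

(* Defs.v *)
(* MathComp-Analysis. *)
From HB Require Import structures.
From mathcomp Require Import all_boot all_order all_algebra.
From mathcomp Require Import all_classical all_reals all_analysis.

Set Implicit Arguments.
Unset Strict Implicit.
Unset Printing Implicit Defensive.

Import Order.TTheory GRing.Theory Num.Theory.
Import numFieldNormedType.Exports.

Local Open Scope classical_set_scope.
Local Open Scope ring_scope.

Section Calculus.
Context {R : realType}.

Definition partial (k : nat) (i : 'I_k.+1) (f : 'cV[R]_k.+1 -> R)
  : 'cV[R]_k.+1 -> R := fun x => 'D_(delta_mx i 0) f x.

Definition smooth_on (k : nat) (W : set 'cV[R]_k.+1) (f : 'cV[R]_k.+1 -> R) :=
  forall (s : seq 'I_k.+1) (x : 'cV[R]_k.+1), W x ->
    differentiable (foldr (@partial k) f s) x.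

(* Partial sum of a power series in k.+1 variables over the multi-indices all
   of whose components are < N. *)
Definition mpsum (k : nat) (c : {ffun 'I_k.+1 -> nat} -> R)
    (x : 'cV[R]_k.+1) (N : nat) : R :=
  \sum_(al : {ffun 'I_k.+1 -> 'I_N})
    c [ffun i => nat_of_ord (al i)] * \prod_i x i 0 ^+ al i.

Definition analytic_at (k : nat) (f : 'cV[R]_k.+1 -> R) (a : 'cV[R]_k.+1) :=
  exists (c : {ffun 'I_k.+1 -> nat} -> R) (e : R), 0 < e /\
    forall x : 'cV[R]_k.+1, `|x - a| < e ->
      cvgn (mpsum (fun al => `|c al|) (map_mx Num.norm (x - a))) /\
      mpsum c (x - a) @ \oo --> f x.

Definition analytic_on (k : nat) (U : set 'cV[R]_k.+1) (f : 'cV[R]_k.+1 -> R) :=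
  forall a, U a -> analytic_at f a.

End Calculus.

Section Holonomy.
Context {R : realType} {k : nat}.
Local Notation point := 'cV[R]_k.+1.

(* A metric on an open subset of R^(k+1), as the matrix of its coefficients. *)
Implicit Types (g : point -> 'M[R]_k.+1) (W : set point).

Definition christoffel g (x : point) (l i j : 'I_k.+1) : R :=
  2^-1 * \sum_a invmx (g x) l a *
    (partial i (fun y => g y j a) x + partial j (fun y => g y i a) x
     - partial a (fun y => g y i j) x).

Definition connection g (x v w : point) : point :=
  \col_l \sum_i \sum_j christoffel g x l i j * v i 0 * w j 0.

(* s lists the break points of [0, 1], with 0 left out and 1 included. *)
Definition piecewise_C1 (s : seq R) (gam : R -> point) :=
  [/\ itv_partition 0 1 s,
      {within `[0, 1], continuous gam} &
      forall i, (i < size s)%N ->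
        exists2 v : R -> point,
          {within `[nth 0 (0 :: s) i, nth 0 s i], continuous v} &
          forall tau, nth 0 (0 :: s) i < tau < nth 0 s i ->
            is_derive tau 1 gam (v tau)].

Definition parallel g (s : seq R) (gam X : R -> point) :=
  {within `[0, 1], continuous X} /\
  forall tau, 0 < tau < 1 -> tau \notin s ->
    is_derive tau 1 X (- connection g (gam tau) (derive1 gam tau) (X tau)).

Definition loop W (p : point) (s : seq R) (gam : R -> point) :=
  [/\ piecewise_C1 s gam, gam 0 = p, gam 1 = p &
      forall tau, 0 <= tau <= 1 -> W (gam tau)].

(* Holonomy group of (W, g) at p, acting on the tangent space at p written in
   the coordinate frame. *)
Definition holonomy g W (p : point) : set 'M[R]_k.+1 :=
  [set A | exists (s : seq R) (gam : R -> point), loop W p s gam /\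
     forall v : point, exists X : R -> point,
       [/\ parallel g s gam X, X 0 = v & X 1 = A *m v]].

End Holonomy.

Section PseudoEuclidean.
Context {R : realType} (n : nat).

Definition eta : 'M[R]_n.+2 :=
  diag_mx (\row_(i < n.+2) (if (i < 2)%N then -1 else 1)).

(* SO(2, n), not only its identity component. *)
Definition SO2 : set 'M[R]_n.+2 := [set A | A^T *m eta *m A = eta /\ \det A = 1].

Definition totally_null_plane (N : {vspace 'cV[R]_n.+2}) :=
  (\dim N = 2)%N /\
  forall v w, v \in N -> w \in N -> v^T *m eta *m w = 0.

Definition SO2_stabiliser (N : {vspace 'cV[R]_n.+2}) : set 'M[R]_n.+2 :=
  [set A | SO2 A /\ (linfun (mulmx A) @: N)%VS = N].

(* The columns of E identify R^{2,n} isometrically with the tangent space at a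
   point where the metric has matrix B. *)
Definition orthonormal_frame (B E : 'M[R]_n.+2) := E^T *m B *m E = eta.

End PseudoEuclidean.

(* Throughout, n = m.+2: the pp-wave has coordinates (x^1, ..., x^m, u, r) and
   h is a function of the m.+1 coordinates (x^1, ..., x^m, u). *)
Section AmbientMetric.
Context {R : realType} (m : nat).

Definition laplacian (f : 'cV[R]_m.+1 -> R) : 'cV[R]_m.+1 -> R :=
  fun z => \sum_(i < m)
    partial (widen_ord (leqnSn m) i) (partial (widen_ord (leqnSn m) i) f) z.

Definition laplacian_iter (k : nat) (f : 'cV[R]_m.+1 -> R) :=
  iter k laplacian f.

(* Ambient coordinates are ordered (rho, x^1, ..., x^m, u, r, t). *)
Local Notation amb := 'cV[R]_m.+4.
Definition i_rho : 'I_m.+4 := ord0.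
Definition i_x (i : 'I_m) : 'I_m.+4 := inord i.+1.
Definition i_u : 'I_m.+4 := inord m.+1.
Definition i_r : 'I_m.+4 := inord m.+2.
Definition i_t : 'I_m.+4 := ord_max.

Definition rho_of (y : amb) : R := y i_rho 0.
Definition t_of (y : amb) : R := y i_t 0.
Definition xu (y : amb) : 'cV[R]_m.+1 := \col_(i < m.+1) y (inord i.+1) 0.

Definition dcoord (i : 'I_m.+4) : 'rV[R]_m.+4 := delta_mx 0 i.

(* Symmetric product of covectors, normalised so that sprod a a is a ^ 2. *)
Definition sprod (a b : 'rV[R]_m.+4) : 'M[R]_m.+4 :=
  2^-1 *: (a^T *m b + b^T *m a).

Variable h : 'cV[R]_m.+1 -> R.

(* Pullback of the pp-wave metric under (rho, x, u, r, t) |-> (x, u, r). *)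
Definition pp_wave (y : amb) : 'M[R]_m.+4 :=
  \sum_(i < m) sprod (dcoord (i_x i)) (dcoord (i_x i))
  + 2 *: sprod (dcoord i_u) (dcoord i_r + h (xu y) *: dcoord i_u).

Definition p_ (k : nat) : R := \prod_(1 <= j < k.+1) ((2 * j)%:R - (m.+2)%:R).

Definition ambient_term (y : amb) (k : nat) : R :=
  laplacian_iter k h (xu y) / (k`!%:R * p_ k) * rho_of y ^+ k.

Definition ambient_psum (y : amb) (N : nat) : R :=
  \sum_(1 <= k < N) ambient_term y k.

(* For n = 2s even, p_ k vanishes for k >= s and the sum stops at k = s - 1. *)
Definition ambient_sum (y : amb) : R :=
  if odd m.+2 then limn (ambient_psum y) else ambient_psum y (m.+2)./2.

Definition ambient_metric (y : amb) : 'M[R]_m.+4 :=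
  2 *: sprod (t_of y *: dcoord i_rho + rho_of y *: dcoord i_t) (dcoord i_t)
  + t_of y ^+ 2 *: (pp_wave y + ambient_sum y *: sprod (dcoord i_u) (dcoord i_u)).

(* W is an open set of ambient coordinates on which the formula for the ambient
   metric makes sense and defines a smooth metric. *)
Definition ambient_domain (U : set 'cV[R]_m.+1) (W : set amb) :=
  [/\ open W,
      forall y, W y -> 0 < t_of y /\ U (xu y),
      odd m.+2 -> forall y, W y -> cvgn (ambient_psum y) &
      forall i j, smooth_on W (fun y => ambient_metric y i j)].

End AmbientMetric.

(* Main.v *)
Require Import Defs.
From mathcomp Require Import all_boot all_order all_algebra.
From mathcomp Require Import all_classical all_reals all_analysis.
From mathcomp Require Import zify ring lra.

Set Implicit Arguments.
Unset Strict Implicit.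
Unset Printing Implicit Defensive.

Import Order.TTheory GRing.Theory Num.Theory.
Import numFieldNormedType.Exports.

Local Open Scope classical_set_scope.
Local Open Scope ring_scope.

(** The ambient metric is governed by one function: in the coordinates
    (rho, x, u, r, t) it is
      t d(rho)dt + t dt d(rho) + 2 rho dt^2 + t^2 (sum dx_i^2 + 2 du dr) + q du^2
    where q = t^2 (2 h + F), with F the sum over powers of rho, does not depend
    on r.  The vector fields e_rho and e_r are orthogonal null fields, and the Christoffel symbols give
      nabla_v e_rho = (v_t / t) e_rho + (v_u (d_rho q) / (2 t^2)) e_r,
      nabla_v e_r   = (v_t / t) e_r - v_u e_rho,
    so their span is a parallel distribution of totally null planes.  Holonomy
    therefore fixes the plane at the base point.

    Turning parallel into fixed by holonomy needs only uniqueness for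
    linear ODEs.  If X is a parallel field along the loop then the functions
    g(e_rho, X) and g(e_r, X) satisfy a homogeneous linear system
    ([parallel_orthogonal]), hence vanish identically when they vanish at time 0
    ([piecewise_linear_ode_zero], an energy estimate on each smooth piece of the
    loop).  So a holonomy matrix A preserves the orthogonal of the plane; as A
    is an isometry it preserves the plane too ([isometry_stabilises],
    [null_plane_stabiliser]).  Working with the orthogonal, by way of lowered
    Christoffel symbols, avoids estimating the inverse of the metric.

    That A is an isometry is the compatibility of the Levi-Civita connection
    with the metric ([connection_compatible], [parallel_isometry]).  Its
    determinant is 1 and not -1 because the determinant of parallel transport is
    continuous along the loop, never zero, and 1 at the start
    ([holonomy_det]). *)

(** * Piecewise linear differential equations *)

Section Partition.
Context {R : realType}.
Implicit Types (a b : R) (s : seq R).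

Lemma itv_partition_ind (Z : R -> Prop) a b s :
  itv_partition a b s ->
  (forall i, (i < size s)%N -> Z (nth 0 (a :: s) i) ->
     forall tau, nth 0 (a :: s) i <= tau <= nth 0 s i -> Z tau) ->
  Z a -> forall tau, a <= tau <= b -> Z tau.
Proof.
elim: s a => [|c s IH] a sab step Za tau.
  by rewrite -(itv_partition_nil sab) => /le_anti <-.
move=> /andP[at_ tb]; have [tc|/ltW ct] := leP tau c.
  by apply: (step 0%N) => //=; rewrite at_.
apply: (IH c (itv_partition_cons sab)); last by rewrite ct tb.
  by move=> i; exact: (step i.+1).
by apply: (step 0%N) => //=; move: sab => [/= /andP[/ltW -> _] _]; rewrite lexx.
Qed.

(** Parallel fields are differentiated only away from the break points; the
    interior of a piece contains none of them. *)
Lemma itv_partition_piece a b s i tau :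
  itv_partition a b s -> (i < size s)%N ->
  nth 0 (a :: s) i < tau < nth 0 s i -> tau \notin s /\ a < tau < b.
Proof.
elim: s a i => // c s IH a [|i] sab.
  move=> _ /= /andP[at_ tc]; have cb := itv_partition_le (itv_partition_cons sab).
  rewrite at_ (lt_le_trans tc cb); split => //.
  case: sab => /= /andP[_ /(order_path_min lt_trans)/allP cs] _.
  rewrite inE negb_or lt_eqF//=; apply/negP => /cs ct.
  by have := lt_trans tc ct; rewrite ltxx.
move=> /= lti tau_in; have sab' := itv_partition_cons sab.
have [tns /andP[ct tb]] := IH _ _ sab' lti tau_in.
rewrite inE negb_or tns gt_eqF//= tb andbT; split => //.
by case: sab => /= /andP[ac _] _; exact: lt_trans ac ct.
Qed.

Lemma itv_partition_piece_sub a b s i :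
  itv_partition a b s -> (i < size s)%N ->
  nth 0 (a :: s) i <= nth 0 s i /\
  `[nth 0 (a :: s) i, nth 0 s i] `<=` `[a, b].
Proof.
elim: s a i => // c s IH a [|i] sab.
  move=> _ /=; have cb := itv_partition_le (itv_partition_cons sab).
  case: sab => /= /andP[/ltW ac _] _; split => //.
  by apply: subset_itv; rewrite bnd_simp.
move=> /= lti; have [-> sub] := IH _ _ (itv_partition_cons sab) lti; split=> //.
apply: (subset_trans sub); case: sab => /= /andP[/ltW ac _] _.
by apply: subset_itv; rewrite bnd_simp.
Qed.

End Partition.

Section Sums.
Context {R : realType}.

Lemma is_derive_bigsum (V : normedModType R) (I : finType) (F : I -> V -> R)
    (dF : I -> R) (x v : V) :
  (forall i, is_derive x v (F i) (dF i)) ->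
  is_derive x v (fun y => \sum_i F i y) (\sum_i dF i).
Proof.
move=> dFi; rewrite -fct_sumE.
apply: (big_ind2 (fun f d => is_derive x v f d)) => //; first exact: is_derive_cst.
by move=> f df g dg ? ?; exact: is_deriveD.
Qed.

Lemma continuous_bigsum (T : topologicalType) (I : finType) (F : I -> T -> R) :
  (forall i, continuous (F i)) -> continuous (fun y => \sum_i F i y).
Proof. by move=> cF; apply: continuous_big => //; exact: add_continuous. Qed.

Lemma continuous_bigprod (T : topologicalType) (I : finType) (F : I -> T -> R) :
  (forall i, continuous (F i)) -> continuous (fun y => \prod_i F i y).
Proof. by move=> cF; apply: continuous_big => //; exact: mul_continuous. Qed.

Lemma continuous_det (T : topologicalType) n (A : T -> 'M[R]_n) :
  (forall i j, continuous (fun y => A y i j)) -> continuous (fun y => \det (A y)).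
Proof.
move=> cA; rewrite /determinant; apply: continuous_bigsum => s y.
by apply: cvgM; [exact: cvg_cst | apply: continuous_bigprod => i; exact: cA].
Qed.

End Sums.

Section LinearODE.
Context {R : realType}.

(** Multiplying phi by the integrating factor exp(- K tau) gives a nonincreasing
    nonnegative function which starts at 0. *)
Lemma gronwall_zero (a b K : R) (phi dphi : R -> R) :
  {within `[a, b], continuous phi} ->
  (forall tau, a < tau < b -> is_derive tau 1 phi (dphi tau)) ->
  (forall tau, a < tau < b -> dphi tau <= K * phi tau) ->
  (forall tau, 0 <= phi tau) -> phi a = 0 ->
  forall tau, a <= tau <= b -> phi tau = 0.
Proof.
move=> cphi dphiE dphi_le phi_ge0 phia tau /andP[at_ tb].
pose e (t : R) := expR (- K * t); pose psi : R -> R := phi * e.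
have dexp (t : R) : is_derive t (1 : R) e (expR (- K * t) * - K).
  apply: (@is_derive1_comp _ expR (fun t => - K * t)).
  rewrite (_ : (fun _ => _) = (- K) \*: id)//.
  by apply: is_derive_eq; rewrite [_ *: _]mulr1.
have dpsi t : a < t < b -> is_derive t 1 psi
    (phi t *: (expR (- K * t) * - K) + expR (- K * t) *: dphi t).
  by move=> tab; have := dphiE t tab => ?; exact: is_deriveM.
have cpsi : {within `[a, b], continuous psi}.
  move=> t; apply: continuousM; first exact: cphi.
  apply: continuous_subspaceT => u.
  by apply/differentiable_continuous/derivable1_diffP; exact: ex_derive.
have psi_le : psi tau <= psi a.
  apply: (@ler0_derive1_le_cc _ psi a b) => //.
  - by move=> t; rewrite in_itv => /dpsi ?; exact: ex_derive.
  - move=> t; rewrite in_itv => tab.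
    have dpt := dpsi t tab; rewrite derive1E derive_val.
    rewrite [_ *: _]mulrCA -[_ *: dphi t]/(_ * _) -mulrDr.
    rewrite pmulr_rle0 ?expR_gt0//.
    by have := dphi_le t tab; lra.
  - by rewrite in_itv/= at_.
  - by rewrite in_itv/= lexx (le_trans at_ tb).
apply/le_anti; rewrite phi_ge0 andbT.
rewrite -(pmulr_lle0 _ (expR_gt0 (- K * tau))).
by apply: le_trans psi_le _; rewrite -[psi a]/(phi a * e a) phia mul0r.
Qed.

(** The energy phi = sum of the squares of the f_k satisfies an inequality
    phi' <= C phi: the coefficients are bounded on the compact interval, and
    2 |f_k f_l| <= f_k^2 + f_l^2. *)
Lemma linear_ode_zero (I : finType) (a b : R) (f : I -> R -> R)
    (c : I -> I -> R -> R) :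
  a <= b ->
  (forall k, {within `[a, b], continuous (f k)}) ->
  (forall k l, {within `[a, b], continuous (c k l)}) ->
  (forall k tau, a < tau < b ->
     is_derive tau 1 (f k) (\sum_l c k l tau * f l tau)) ->
  (forall k, f k a = 0) ->
  forall tau, a <= tau <= b -> forall k, f k tau = 0.
Proof.
move=> ab cf cc df fa.
have cC : {within `[a, b], continuous (fun t => \sum_k \sum_l `|c k l t|)}.
  apply: continuous_bigsum => k; apply: continuous_bigsum => l t.
  by apply: (continuous_comp (cc k l t)); exact: norm_continuous.
have [K K0 c_le] : exists2 K, 0 <= K &
    forall k l t, a <= t <= b -> `|c k l t| <= K.
  have [m _ mC] := EVT_max ab cC.
  exists (\sum_k \sum_l `|c k l m|).
    by apply: sumr_ge0 => *; apply: sumr_ge0.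
  move=> k l t tab; apply: le_trans (mC t _); last by rewrite in_itv.
  rewrite (bigD1 k)//= (bigD1 l)//= -addrA lerDl addr_ge0//; apply: sumr_ge0 => //.
  by move=> i _; exact: sumr_ge0.
pose phi t := \sum_k f k t ^+ 2.
have phi0 t : a <= t <= b -> phi t = 0.
  apply: (@gronwall_zero a b (2 * K * #|I|%:R) phi
    (fun t => \sum_k 2 * f k t * (\sum_l c k l t * f l t))).
  - apply: continuous_bigsum => k.
    rewrite (_ : (fun _ => _) = f k * f k); last by apply/funext => u; rewrite expr2.
    by move=> u; apply: continuousM; exact: cf.
  - move=> u uab; apply: is_derive_bigsum => k; have := df k u uab => ?.
    rewrite (_ : (fun _ => _) = f k ^+ 2); last by apply/funext => w; rewrite exprfctE.
    by apply: is_derive_eq; rewrite expr1.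
  - move=> u /andP[/ltW au /ltW ub].
    have cu k l : `|c k l u| <= K by rewrite c_le// au.
    apply: (@le_trans _ _ (\sum_(k : I) \sum_(l : I) K * (f k u ^+ 2 + f l u ^+ 2))).
      apply: ler_sum => k _; rewrite mulr_sumr; apply: ler_sum => l _.
      apply: le_trans (ler_norm _) _; rewrite mulrCA normrM.
      apply: ler_pM => //; rewrite normrM normrM ger0_norm//.
      rewrite -(real_normK (num_real (f k u))) -(real_normK (num_real (f l u))).
      have := sqr_ge0 (`|f k u| - `|f l u|); rewrite !expr2; lra.
    rewrite le_eqVlt; apply/orP; left; apply/eqP.
    transitivity (\sum_(k : I) (K * #|I|%:R * f k u ^+ 2 + K * phi u)).
      apply: eq_bigr => k _; rewrite -mulr_sumr big_split/= sumr_const -/(phi u).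
      by rewrite -[f k u ^+ 2 *+ _]mulr_natl; ring.
    rewrite big_split/= -mulr_sumr -/(phi u) sumr_const -[K * phi u *+ _]mulr_natl.
    by ring.
  - by move=> u; apply: sumr_ge0 => k _; exact: sqr_ge0.
  - by rewrite /phi big1// => k _; rewrite fa expr0n.
move=> tau /phi0/eqP; rewrite psumr_eq0 => [/allP f0 k|k _]; last exact: sqr_ge0.
by have := f0 k; rewrite mem_index_enum sqrf_eq0/= => /(_ isT)/eqP.
Qed.

Lemma piecewise_linear_ode_zero (I : finType) (a b : R) (s : seq R)
    (f : I -> R -> R) :
  itv_partition a b s ->
  (forall k, {within `[a, b], continuous (f k)}) ->
  (forall i, (i < size s)%N -> exists c : I -> I -> R -> R,
     (forall k l, {within `[nth 0 (a :: s) i, nth 0 s i], continuous (c k l)}) /\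
     forall k tau, nth 0 (a :: s) i < tau < nth 0 s i ->
       is_derive tau 1 (f k) (\sum_l c k l tau * f l tau)) ->
  (forall k, f k a = 0) ->
  forall tau, a <= tau <= b -> forall k, f k tau = 0.
Proof.
move=> sab cf df fa tau tau_in.
apply: (itv_partition_ind (Z := fun t => forall k, f k t = 0) sab) => //.
move=> i lti fi t t_in; have [le_i sub_i] := itv_partition_piece_sub sab lti.
have [c [cc dc]] := df i lti.
apply: (linear_ode_zero le_i _ cc dc) => // k.
exact: continuous_subspaceW sub_i (cf k).
Qed.

End LinearODE.
(** * The Levi-Civita connection *)

Section Pairing.
Context {R : realType} {k : nat}.
Local Notation point := 'cV[R]_k.+1.

Definition pairing (G : 'M[R]_k.+1) (v w : point) : R := (v^T *m G *m w) 0 0.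

Lemma pairingE G v w :
  pairing G v w = \sum_a \sum_b v a 0 * G a b * w b 0.
Proof.
rewrite /pairing mxE exchange_big; apply: eq_bigr => b _.
by rewrite mxE mulr_suml; apply: eq_bigr => a _; rewrite mxE.
Qed.

Lemma pairing_lowerE G v w : pairing G v w = \sum_a v a 0 * (G *m w) a 0.
Proof. by rewrite /pairing -mulmxA mxE; apply: eq_bigr => a _; rewrite mxE. Qed.

Lemma pairingC G v w : G^T = G -> pairing G v w = pairing G w v.
Proof.
move=> GT; rewrite /pairing; transitivity ((v^T *m G *m w)^T 0 0).
  by rewrite [RHS]mxE.
by rewrite !trmx_mul trmxK GT mulmxA.
Qed.

Lemma pairing_delta G i j : pairing G (delta_mx i 0) (delta_mx j 0) = G i j.
Proof. by rewrite /pairing trmx_delta -rowE -colE !mxE. Qed.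

Lemma pairing_mul G A v w : pairing G (A *m v) (A *m w) = pairing (A^T *m G *m A) v w.
Proof. by rewrite /pairing trmx_mul !mulmxA. Qed.

Lemma pairing_inj G H : (forall v w, pairing G v w = pairing H v w) -> G = H.
Proof. by move=> GH; apply/matrixP => i j; rewrite -!pairing_delta. Qed.

Lemma pairingDl G u v w : pairing G (u + v) w = pairing G u w + pairing G v w.
Proof. by rewrite /pairing linearD /= !mulmxDl mxE. Qed.

Lemma pairingDr G u v w : pairing G w (u + v) = pairing G w u + pairing G w v.
Proof. by rewrite /pairing mulmxDr mxE. Qed.

Lemma pairingZl G c v w : pairing G (c *: v) w = c * pairing G v w.
Proof. by rewrite /pairing linearZ /= -!scalemxAl mxE. Qed.

Lemma pairingZr G c v w : pairing G v (c *: w) = c * pairing G v w.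
Proof. by rewrite /pairing -scalemxAr mxE. Qed.

Lemma pairing0l G w : pairing G 0 w = 0.
Proof. by rewrite /pairing linear0 !mul0mx mxE. Qed.

Lemma pairing0r G w : pairing G w 0 = 0.
Proof. by rewrite /pairing mulmx0 mxE. Qed.

Lemma pairing_suml (I : finType) G (c : I -> R) (v : I -> point) w :
  pairing G (\sum_i c i *: v i) w = \sum_i c i * pairing G (v i) w.
Proof.
elim/big_ind2: _ => [|u a u' a' <- <-|i _]; rewrite ?pairing0l//.
  by rewrite pairingDl.
by rewrite pairingZl.
Qed.

End Pairing.

Section LeviCivita.
Context {R : realType} {k : nat}.
Local Notation point := 'cV[R]_k.+1.
Implicit Types (g : point -> 'M[R]_k.+1) (W : set point) (gam : R -> point).

(** Christoffel symbols of the first kind: they are free of the inverse metric,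
    which [lower_connection] cancels against the metric. *)
Definition lowered_christoffel g (x : point) (a i j : 'I_k.+1) : R :=
  2^-1 * (partial i (fun y => g y j a) x + partial j (fun y => g y i a) x
          - partial a (fun y => g y i j) x).

Lemma lower_connection g x v w a : g x \in unitmx ->
  (g x *m connection g x v w) a 0 =
  \sum_i \sum_j lowered_christoffel g x a i j * v i 0 * w j 0.
Proof.
move=> gU; rewrite [connection _ _ _ _](_ : _ = invmx (g x) *m
  \col_a \sum_i \sum_j lowered_christoffel g x a i j * v i 0 * w j 0).
  by rewrite mulKVmx// mxE.
apply/colP => l; rewrite !mxE.
under [RHS]eq_bigr do rewrite mxE mulr_sumr.
rewrite [RHS]exchange_big; apply: eq_bigr => i _.
under [RHS]eq_bigr do rewrite mulr_sumr.
rewrite [RHS]exchange_big; apply: eq_bigr => j _.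
rewrite /christoffel mulr_sumr !mulr_suml; apply: eq_bigr => b _.
by rewrite /lowered_christoffel; ring.
Qed.

(** In the two lowered Christoffel symbols, exchanged by the symmetry of g, the
    terms other than d_i g_ab cancel: nabla g = 0. *)
Lemma connection_compatible g x v X Y :
  (forall y, (g y)^T = g y) -> g x \in unitmx ->
  pairing (g x) (connection g x v X) Y + pairing (g x) X (connection g x v Y) =
  \sum_a \sum_b
    X a 0 * (\sum_i v i 0 * partial i (fun y => g y a b) x) * Y b 0.
Proof.
move=> gT gU; have gC a b : (fun y => g y a b) = (fun y => g y b a).
  by apply/funext => y; rewrite -[in LHS]gT mxE.
rewrite (pairingC (connection _ _ _ _))// !pairing_lowerE.
have expand (Z V : point) : \sum_a Z a 0 * (g x *m connection g x v V) a 0 =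
    \sum_a \sum_b \sum_i Z a 0 * lowered_christoffel g x a i b * v i 0 * V b 0.
  apply: eq_bigr => a _; rewrite lower_connection// exchange_big mulr_sumr.
  apply: eq_bigr => b _; rewrite mulr_sumr; apply: eq_bigr => i _; ring.
rewrite !expand [X in X + _]exchange_big -big_split/=; apply: eq_bigr => a _.
rewrite -big_split/=; apply: eq_bigr => b _.
rewrite mulr_sumr mulr_suml -big_split/=; apply: eq_bigr => i _.
rewrite /lowered_christoffel (gC b a) (gC i a) (gC i b); by field.
Qed.

Lemma is_derive_coord (V : normedModType R) m n (M : V -> 'M[R]_(m, n)) x v dM i j :
  is_derive x v M dM -> is_derive x v (fun y => M y i j) (dM i j).
Proof.
move=> dMx; have /derivable_mxP Mij : derivable M x v by exact: ex_derive.
apply: DeriveDef; first exact: Mij.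
have <- : 'D_v M x = dM by exact: derive_val.
by rewrite derive_mx ?mxE.
Qed.

Lemma is_derive_chain (f : point -> R) gam tau v :
  differentiable f (gam tau) -> is_derive tau 1 gam v ->
  is_derive tau 1 (f \o gam) (\sum_i v i 0 * partial i f (gam tau)).
Proof.
move=> df dgam; have gamD : differentiable gam tau.
  by apply/derivable1_diffP; exact: ex_derive.
apply: DeriveDef.
  by apply/derivable1_diffP; exact: differentiable_comp.
rewrite deriveE; last exact: differentiable_comp.
have gv : 'd gam tau 1 = v by rewrite -deriveE// derive_val.
rewrite diff_comp//= gv [in LHS](matrix_sum_delta v).
rewrite linear_sum; apply: eq_bigr => i _.
by rewrite big_ord1 linearZ /partial deriveE.
Qed.

(** Leibniz rule d/dtau g(X, Y) = g(DX, Y) + g(X, DY), with D the covariant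
    derivative along gam.  It is used both for two parallel fields and for a
    parallel field against a constant one. *)
Lemma is_derive_pairing g gam X Y tau v dX dY :
  (forall y, (g y)^T = g y) -> g (gam tau) \in unitmx ->
  (forall a b, differentiable (fun y => g y a b) (gam tau)) ->
  is_derive tau 1 gam v -> is_derive tau 1 X dX -> is_derive tau 1 Y dY ->
  is_derive tau 1 (fun s => pairing (g (gam s)) (X s) (Y s))
    (pairing (g (gam tau)) (dX + connection g (gam tau) v (X tau)) (Y tau)
     + pairing (g (gam tau)) (X tau) (dY + connection g (gam tau) v (Y tau))).
Proof.
move=> gT gU gD dgam dXt dYt.
have gC a b : (fun y => g y a b) = (fun y => g y b a).
  by apply/funext => y; rewrite -[in LHS]gT mxE.
rewrite (_ : (fun s => _) =
    fun s => \sum_a \sum_b X s a 0 * g (gam s) a b * Y s b 0); last first.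
  by apply/funext => s; rewrite pairingE.
pose dg a b := \sum_i v i 0 * partial i (fun y => g y a b) (gam tau).
have dF a b : is_derive tau 1 (fun s => X s a 0 * g (gam s) a b * Y s b 0)
   (dX a 0 * g (gam tau) a b * Y tau b 0 + X tau a 0 * dg a b * Y tau b 0
    + X tau a 0 * g (gam tau) a b * dY b 0).
  have dXa := is_derive_coord a 0 dXt; have dYb := is_derive_coord b 0 dYt.
  have dgab : is_derive tau 1 (fun s => g (gam s) a b) (dg a b).
    exact: (is_derive_chain (gD a b) dgam).
  apply: is_derive_eq (is_deriveM (is_deriveM dXa dgab) dYb) _.
  rewrite /= -![_ *: _]/(_ * _) -[(_ * _) tau]/(X tau a 0 * g (gam tau) a b).
  by ring.
have dS := is_derive_bigsum (fun a => is_derive_bigsum (dF a)).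
apply: is_derive_eq dS _.
rewrite pairingDl pairingDr addrACA connection_compatible// !pairingE -!big_split/=.
apply: eq_bigr => a _; rewrite -!big_split/=; apply: eq_bigr => b _.
by rewrite /dg; ring.
Qed.

End LeviCivita.

(** * Holonomy *)

Section Holonomy.
Context {R : realType} {k : nat}.
Local Notation point := 'cV[R]_k.+1.
Variables (g : point -> 'M[R]_k.+1) (W : set point).
Hypothesis gT : forall y, (g y)^T = g y.
Hypothesis gU : forall y, W y -> g y \in unitmx.
Hypothesis gD : forall y i j, W y -> differentiable (fun z => g z i j) y.

Lemma continuous_along (gam : R -> point) (f : point -> R) :
  {within `[0, 1], continuous gam} ->
  (forall tau, 0 <= tau <= 1 -> W (gam tau)) ->
  (forall y, W y -> {for y, continuous f}) ->
  {within `[0, 1], continuous (f \o gam)}.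
Proof.
move=> cgam gamW cf; apply: within_continuous_comp cgam => y.
rewrite inE => -[tau /=]; rewrite in_itv/= => tau01 <-.
exact/cf/gamW.
Qed.

Lemma continuous_coord (m n : nat) (A : set R) (M : R -> 'M[R]_(m, n)) i j :
  {within A, continuous M} -> {within A, continuous (fun s => M s i j)}.
Proof.
move=> cM.
apply: (@within_continuous_comp _ _ _ A M (fun N : 'M[R]_(m, n) => N i j)) cM.
by move=> y _; exact: coord_continuous.
Qed.

Lemma continuous_metric_along (gam : R -> point) i j :
  {within `[0, 1], continuous gam} ->
  (forall tau, 0 <= tau <= 1 -> W (gam tau)) ->
  {within `[0, 1], continuous (fun s => g (gam s) i j)}.
Proof.
move=> cgam gamW.
apply: (continuous_along (f := fun y => g y i j)) cgam gamW _ => y Wy.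
exact/differentiable_continuous/gD.
Qed.

Lemma continuous_pairing (gam X Y : R -> point) :
  {within `[0, 1], continuous gam} ->
  (forall tau, 0 <= tau <= 1 -> W (gam tau)) ->
  {within `[0, 1], continuous X} -> {within `[0, 1], continuous Y} ->
  {within `[0, 1], continuous (fun s => pairing (g (gam s)) (X s) (Y s))}.
Proof.
move=> cgam gamW cX cY.
rewrite (_ : (fun s => _) =
    fun s => \sum_a \sum_b X s a 0 * g (gam s) a b * Y s b 0); last first.
  by apply/funext => s; rewrite pairingE.
apply: continuous_bigsum => a; apply: continuous_bigsum => b s.
apply: (@cvgM _ (subspace `[0, 1])); last exact: continuous_coord.
apply: (@cvgM _ (subspace `[0, 1])); first exact: continuous_coord.
exact: continuous_metric_along.
Qed.

Section AlongLoop.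
Variables (p : point) (s : seq R) (gam : R -> point).
Hypothesis gam_loop : loop W p s gam.

Let sP : itv_partition 0 1 s. Proof. by case: gam_loop => -[]. Qed.
Let cgam : {within `[0, 1], continuous gam}. Proof. by case: gam_loop => -[]. Qed.
Let gamW : forall tau, 0 <= tau <= 1 -> W (gam tau).
Proof. by case: gam_loop. Qed.

Lemma parallel_derive X v i tau : parallel g s gam X -> (i < size s)%N ->
  nth 0 (0 :: s) i < tau < nth 0 s i -> is_derive tau 1 gam v ->
  W (gam tau) /\
  is_derive tau 1 X (- connection g (gam tau) v (X tau)).
Proof.
move=> [_ dX] lti tau_in dgam.
have [tau_s tau01] := itv_partition_piece sP lti tau_in.
have <- : derive1 gam tau = v by rewrite derive1E derive_val.
split; last exact: dX.
by apply: gamW; move: tau01 => /andP[/ltW -> /ltW ->].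
Qed.

(** By [is_derive_pairing], g(X, Y) has derivative 0 on each smooth piece; it is
    the instance of [piecewise_linear_ode_zero] with one unknown and zero
    coefficient. *)
Lemma parallel_isometry X Y : parallel g s gam X -> parallel g s gam Y ->
  forall tau, 0 <= tau <= 1 ->
  pairing (g (gam tau)) (X tau) (Y tau) = pairing (g p) (X 0) (Y 0).
Proof.
move=> pX pY tau tau01; pose c := pairing (g p) (X 0) (Y 0).
pose f (_ : unit) t := pairing (g (gam t)) (X t) (Y t) - c.
suff /(_ tau tau01 tt)/subr0_eq : forall t, 0 <= t <= 1 -> forall u, f u t = 0.
  by [].
apply: (piecewise_linear_ode_zero sP).
- case; apply: (@within_continuousB _ _ _ _ _ (cst c)).
    by apply: continuous_pairing => //; [case: pX | case: pY].
  by move=> ?; exact: cvg_cst.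
- move=> i lti; exists (fun _ _ => cst 0); split.
    by move=> ? ? ?; exact: cvg_cst.
  move=> [] t t_in; rewrite big1; last by move=> l _; rewrite mul0r.
  case: gam_loop => -[_ _ /(_ i lti)[v _ /(_ t t_in) dgam]] _ _ _.
  have [Wt dX] := parallel_derive pX lti t_in dgam.
  have [_ dY] := parallel_derive pY lti t_in dgam.
  have dP := is_derive_pairing gT (gU Wt) (fun a b => gD a b Wt) dgam dX dY.
  apply: is_derive_eq (is_deriveB dP (is_derive_cst c _ _)) _.
  by rewrite !addNr pairing0l pairing0r addr0 subr0.
- by case; case: gam_loop => _ gam0 _ _; rewrite /f gam0 subrr.
Qed.

(** The orthogonal of a parallel distribution is invariant under parallel
    transport.  The distribution is given by a frame w of constant coefficients
    with connection form om, and the functions g(w_a, X) satisfy the linear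
    system whose matrix is om evaluated on the velocity of gam. *)
Lemma parallel_orthogonal (I : finType) (w : I -> point)
    (om : I -> I -> 'I_k.+1 -> point -> R) X :
  (forall a b i y, W y -> {for y, continuous (om a b i)}) ->
  (forall y v a, W y ->
     connection g y v (w a) = \sum_b (\sum_i om a b i y * v i 0) *: w b) ->
  parallel g s gam X -> (forall a, pairing (g p) (w a) (X 0) = 0) ->
  forall tau, 0 <= tau <= 1 -> forall a, pairing (g (gam tau)) (w a) (X tau) = 0.
Proof.
move=> com conn_w pX X0.
apply: (piecewise_linear_ode_zero (f := fun a t => pairing (g (gam t)) (w a) (X t)) sP).
- by move=> a; apply: continuous_pairing => //; [move=> ?; exact: cvg_cst | case: pX].
- move=> i lti; have [le_i sub_i] := itv_partition_piece_sub sP lti.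
  case: gam_loop => -[_ _ /(_ i lti)[v cv dgam]] _ _ _.
  exists (fun a b t => \sum_j om a b j (gam t) * v t j 0); split.
    move=> a b; apply: continuous_bigsum => j t.
    apply: (@cvgM _ (subspace _)); last exact: continuous_coord.
    apply: (continuous_subspaceW sub_i) => {}t.
    by apply: (continuous_along (f := om a b j)) => // y Wy; exact: com.
  move=> a t t_in.
  have [Wt dX] := parallel_derive pX lti t_in (dgam t t_in).
  have dP := is_derive_pairing gT (gU Wt) (fun a b => gD a b Wt) (dgam t t_in)
    (is_derive_cst (w a) _ _) dX.
  apply: is_derive_eq dP _.
  by rewrite addNr pairing0r addr0 add0r conn_w// pairing_suml.
- by case: gam_loop => _ gam0 _ _ a; rewrite gam0.
Qed.

End AlongLoop.

Lemma holonomy_isometry p A : W p -> holonomy g W p A ->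
  A^T *m g p *m A = g p.
Proof.
move=> Wp [s [gam [gam_loop transport]]]; apply: pairing_inj => v w.
rewrite -pairing_mul; have [X [pX <- <-]] := transport v.
have [Y [pY <- <-]] := transport w.
case: (gam_loop) => _ _ gam1 _; rewrite -{1}gam1.
by apply: (parallel_isometry gam_loop) => //; rewrite lexx ler01.
Qed.

(** Being an isometry only gives determinant 1 or -1.  The matrices P t of
    parallel transport up to time t join the identity to A, and their
    determinants do not vanish since P t is an isometry from the metric at p to
    the metric at gam t; a determinant -1 would contradict the intermediate
    value theorem. *)
Lemma holonomy_det p A : W p -> holonomy g W p A -> \det A = 1.
Proof.
move=> Wp holA; have [s [gam [gam_loop transport]]] := holA.
have [F FP] := choice transport.
pose P t : 'M[R]_k.+1 := \matrix_(i, j) F (delta_mx j 0) t i 0.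
have cP : {within `[0, 1], continuous (fun t => \det (P t))}.
  apply: continuous_det => i j.
  rewrite (_ : (fun y => _) = (fun y => F (delta_mx j 0) y i 0)).
    by apply: continuous_coord; have [[]] := FP (delta_mx j 0).
  by apply/funext => t; rewrite mxE.
have colP t j : P t *m delta_mx j 0 = F (delta_mx j 0) t.
  by rewrite -colE; apply/colP => i; rewrite !mxE.
have P1 : P 1 = A.
  apply/matrixP => i j; rewrite mxE; have [_ _ ->] := FP (delta_mx j 0).
  by rewrite -colE mxE.
have P0 : P 0 = 1%:M.
  apply/matrixP => i j; rewrite mxE; have [_ -> _] := FP (delta_mx j 0).
  by rewrite !mxE eqxx andbT.
have P_unit t : 0 <= t <= 1 -> \det (P t) != 0.
  move=> t01; suff PgP : (P t)^T *m g (gam t) *m P t = g p.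
    have : \det (g p) != 0 by rewrite -unitfE; exact: gU.
    by rewrite -PgP !det_mulmx; apply: contra_neq => ->; rewrite mulr0.
  apply/matrixP => i j; rewrite -!pairing_delta -pairing_mul !colP.
  have [pX X0 _] := FP (delta_mx i 0); have [pY Y0 _] := FP (delta_mx j 0).
  by rewrite (parallel_isometry gam_loop pX pY t01) X0 Y0.
have detA2 : \det A * \det A = 1.
  have g0 : \det (g p) != 0 by rewrite -unitfE; exact: gU.
  apply: (mulIf g0); rewrite mul1r -[in RHS](holonomy_isometry Wp holA).
  by rewrite !det_mulmx det_tr; ring.
have [A_ge0|A_lt0] := leP 0 (\det A).
  by apply/eqP; rewrite -(eqrXn2 (n := 2))// expr1n expr2 detA2.
have [] := @IVT _ (fun t => \det (P t)) 0 1 0 ler01 cP.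
  rewrite P0 P1 det1 (min_idPr _) ?(max_idPl _) ?ler01 ?andbT; apply: ltW => //.
  - exact: lt_trans A_lt0 ltr01.
  - exact: lt_trans A_lt0 ltr01.
by move=> t; rewrite in_itv => /P_unit/eqP.
Qed.

End Holonomy.

(** * Stabilisers of null planes *)

Section NullPlaneStabiliser.
Context {R : realType} (n : nat).
Implicit Types (A B E : 'M[R]_n.+2) (w : 'M[R]_(n.+2, 2)).

Lemma eta_unit : @eta R n \in unitmx.
Proof.
rewrite unitmxE det_diag unitfE; apply/prodf_neq0 => i _; rewrite mxE.
by case: ifP; rewrite ?oppr_eq0 oner_eq0.
Qed.

Lemma orthonormal_frame_unit B E :
  orthonormal_frame B E -> (B \in unitmx) && (E \in unitmx).
Proof.
move=> frameE; have := eta_unit; rewrite -frameE !unitmx_mul.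
by move=> /andP[/andP[_ ->] ->].
Qed.

(** If an isometry A preserves the B-orthogonal of the columns of w, then the
    inverse of A preserves their span.  Indeed the rows of w^T B A vanish on the
    kernel of w^T B, so w^T B A = D w^T B for some D, and A^T B A = B turns this
    relation into w = A w D^T. *)
Lemma isometry_stabilises d B A (w : 'M[R]_(n.+2, d)) :
  B \in unitmx -> A \in unitmx -> A^T *m B *m A = B ->
  (forall X : 'cV[R]_n.+2, w^T *m B *m X = 0 -> w^T *m B *m (A *m X) = 0) ->
  exists D : 'M[R]_d, w = A *m w *m D.
Proof.
move=> BU AU isoA presA; pose J := w^T *m B.
have /submxP[D JA] : (J *m A <= J)%MS.
  rewrite submxE; apply/eqP/matrixP => i j.
  have -> : (J *m A *m cokermx J) i j = (J *m (A *m col j (cokermx J))) i 0.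
    by rewrite colE !mulmxA -colE [RHS]mxE.
  by rewrite presA ?mxE// -/J colE mulmxA mulmx_coker mul0mx.
exists D^T; apply: trmx_inj; apply: (can_inj (mulmxK BU)).
rewrite !trmx_mul trmxK -!mulmxA.
apply: (can_inj (mulmxK AU)); rewrite -!mulmxA.
by rewrite [A^T *m _]mulmxA isoA mulmxA -/J JA.
Qed.

(** The plane is spanned by the columns of w, read in the frame E.  From
    w = A w D it is contained in its image by A, and both have the same
    dimension. *)
Lemma null_plane_stabiliser B E w :
  orthonormal_frame B E -> w^T *m w = 1%:M -> w^T *m B *m w = 0 ->
  exists N : {vspace 'cV[R]_n.+2}, totally_null_plane N /\
    forall A, A^T *m B *m A = B -> \det A = 1 ->
      (forall X : 'cV[R]_n.+2, w^T *m B *m X = 0 -> w^T *m B *m (A *m X) = 0) ->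
      SO2_stabiliser N (invmx E *m A *m E).
Proof.
move=> frameE ww1 wBw; have /andP[BU EU] := orthonormal_frame_unit frameE.
pose f : 'Hom('cV[R]_2, 'cV[R]_n.+2) := linfun (mulmx (invmx E *m w)).
exists (limg f); split; first split.
- have kf : lker f = 0%VS.
    apply/eqP; rewrite -subv0; apply/subvP => c; rewrite memv_ker lfunE/= memv0.
    move=> /eqP/(congr1 (mulmx (w^T *m E))).
    by rewrite !mulmxA mulmxK// ww1 mul1mx mulmx0 => ->.
  have := limg_ker_dim f fullv; rewrite kf capv0 dimv0 add0n => ->.
  by rewrite dimvf /dim/= muln1.
- move=> _ _ /memv_imgP[c _ ->] /memv_imgP[c' _ ->]; rewrite !lfunE/= -frameE.
  rewrite !trmx_mul -!mulmxA (mulKVmx EU) [(invmx E)^T *m _]mulmxA -trmx_mul.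
  rewrite mulmxV// trmx1 mul1mx.
  by rewrite [w^T *m _]mulmxA [w^T *m _ *m _]mulmxA wBw mul0mx mulmx0.
- move=> A isoA detA presA.
  have AU : A \in unitmx by rewrite unitmxE detA unitr1.
  have [D wE] := isometry_stabilises BU AU isoA presA.
  split; first split.
  + rewrite -frameE !trmx_mul -!mulmxA (mulKVmx EU).
    rewrite [(invmx E)^T *m _]mulmxA -trmx_mul mulmxV// trmx1 mul1mx.
    by rewrite [B *m _]mulmxA [A^T *m _]mulmxA [A^T *m _]mulmxA isoA.
  + by rewrite !det_mulmx detA mulr1 -det_mulmx mulVmx// det1.
  + apply/eqP; rewrite eq_sym eqEdim; apply/andP; split; last first.
      rewrite -[X in (_ <= X)%N](limg_ker_dim (linfun (mulmx (invmx E *m A *m E)))).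
      exact: leq_addl.
    apply/subvP => _ /memv_imgP[c _ ->].
    apply/memv_imgP; exists (f (D *m c)); first exact: memv_img (memvf _).
    by rewrite !lfunE/= {1}wE -!mulmxA (mulKVmx EU).
Qed.

End NullPlaneStabiliser.

(** * The ambient metric in coordinates *)

Section AmbientMetric.
Context {R : realType} (m : nat) (h : 'cV[R]_m.+1 -> R).
Local Notation amb := 'cV[R]_m.+4.
Local Notation irho := (i_rho m).
Local Notation iu := (i_u m).
Local Notation ir := (i_r m).
Local Notation it := (i_t m).
Local Notation e := (fun i : 'I_m.+4 => delta_mx i 0 : amb).

Lemma val_i_x (l : 'I_m) : val (i_x l) = l.+1.
Proof. by rewrite /= inordK//; have := ltn_ord l; lia. Qed.

Lemma val_i_u : val iu = m.+1.
Proof. by rewrite /= inordK//; lia. Qed.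

Lemma val_i_r : val ir = m.+2.
Proof. by rewrite /= inordK//; lia. Qed.

Lemma index_eq :
  ((irho == iu) = false) * ((irho == ir) = false) * ((irho == it) = false) *
  ((iu == irho) = false) * ((iu == ir) = false) * ((iu == it) = false) *
  ((ir == irho) = false) * ((ir == iu) = false) * ((ir == it) = false) *
  ((it == irho) = false) * ((it == iu) = false) * ((it == ir) = false).
Proof.
by do ![split]; rewrite -[LHS]val_eqE ?val_i_u ?val_i_r//=; lia.
Qed.

Lemma index_x_eq (l l' : 'I_m) :
  ((i_x l == irho) = false) * ((i_x l == iu) = false) *
  ((i_x l == ir) = false) * ((i_x l == it) = false) *
  ((irho == i_x l) = false) * ((iu == i_x l) = false) *
  ((ir == i_x l) = false) * ((it == i_x l) = false) *
  ((i_x l == i_x l') = (l == l')).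
Proof.
have ll := ltn_ord l; have ll' := ltn_ord l'.
by do ![split]; rewrite -[LHS]val_eqE ?val_i_x ?val_i_u ?val_i_r//=; lia.
Qed.

Definition uu_coef (y : amb) : R :=
  t_of y ^+ 2 * (2 * h (xu y) + ambient_sum h y).

(** The matrix of sum dx_i^2 + 2 du dr. *)
Definition flat_part : 'M[R]_m.+4 :=
  \sum_(l < m) delta_mx (i_x l) (i_x l) + (delta_mx iu ir + delta_mx ir iu).

Lemma ambient_metricE y : ambient_metric h y =
  t_of y *: (delta_mx irho it + delta_mx it irho)
  + (2 * rho_of y) *: delta_mx it it
  + t_of y ^+ 2 *: flat_part + uu_coef y *: delta_mx iu iu.
Proof.
have dd i j : (dcoord i : 'rV[R]_m.+4)^T *m dcoord j = delta_mx i j.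
  by rewrite /dcoord trmx_delta mul_delta_mx.
have ss (a : 'rV[R]_m.+4) : sprod a a = a^T *m a.
  by rewrite /sprod -mulr2n -[X in _ *: X]scaler_nat scalerA mulVf ?scale1r// pnatr_eq0.
have s2 (a b : 'rV[R]_m.+4) : 2 *: sprod a b = a^T *m b + b^T *m a.
  by rewrite /sprod scalerA mulfV ?scale1r// pnatr_eq0.
rewrite /ambient_metric /pp_wave !s2 !ss !linearD /= !linearZ /=.
rewrite !mulmxDl -?scalemxAl -?scalemxAr !dd.
under eq_bigr do rewrite ss dd.
apply/matrixP => i j; rewrite /flat_part /uu_coef !mxE; ring.
Qed.

Lemma pairing_ambient y v w : pairing (ambient_metric h y) v w =
  t_of y * (v irho 0 * w it 0 + v it 0 * w irho 0)
  + 2 * rho_of y * (v it 0 * w it 0)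
  + t_of y ^+ 2 * (\sum_(l < m) v (i_x l) 0 * w (i_x l) 0
                   + (v iu 0 * w ir 0 + v ir 0 * w iu 0))
  + uu_coef y * (v iu 0 * w iu 0).
Proof.
have pD G H : pairing (G + H) v w = pairing G v w + pairing H v w.
  by rewrite /pairing mulmxDr mulmxDl mxE.
have pZ c G : pairing (c *: G) v w = c * pairing G v w.
  by rewrite /pairing -scalemxAr -scalemxAl mxE.
have pd i j : pairing (delta_mx i j) v w = v i 0 * w j 0.
  rewrite -(mul_delta_mx (0 : 'I_1)) /pairing mulmxA -mulmxA mxE big_ord1.
  by rewrite -colE -rowE !mxE.
rewrite ambient_metricE /flat_part.
have ps : pairing (\sum_(l < m) delta_mx (i_x l) (i_x l)) v w =
    \sum_(l < m) v (i_x l) 0 * w (i_x l) 0.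
  elim/big_ind2: _ => [|a G b H <- <-|l _]; rewrite ?pD ?pd//.
  by rewrite /pairing mulmx0 mul0mx mxE.
by rewrite !(pD, pZ, pd) ps.
Qed.

Lemma ambient_metric_sym y : (ambient_metric h y)^T = ambient_metric h y.
Proof.
apply: pairing_inj => v w.
have -> : pairing (ambient_metric h y)^T v w = pairing (ambient_metric h y) w v.
  rewrite /pairing; transitivity ((w^T *m ambient_metric h y *m v)^T 0 0).
    by rewrite !trmx_mul trmxK mulmxA.
  by rewrite mxE.
rewrite !pairing_ambient.
under eq_bigr do rewrite mulrC.
by ring.
Qed.

Lemma ambient_entry y i j : ambient_metric h y i j =
  t_of y * (((i == irho) && (j == it))%:R + ((i == it) && (j == irho))%:R)
  + 2 * rho_of y * ((i == it) && (j == it))%:R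
  + t_of y ^+ 2 * flat_part i j + uu_coef y * ((i == iu) && (j == iu))%:R.
Proof. by rewrite ambient_metricE; move: flat_part => Q; rewrite !mxE. Qed.

Lemma is_derive_ambient y v dq i j : is_derive y v uu_coef dq ->
  is_derive y v (fun z => ambient_metric h z i j)
    (v it 0 * (((i == irho) && (j == it))%:R + ((i == it) && (j == irho))%:R)
     + 2 * v irho 0 * ((i == it) && (j == it))%:R
     + 2 * t_of y * v it 0 * flat_part i j
     + dq * ((i == iu) && (j == iu))%:R).
Proof.
move=> dq_.
have drho : is_derive y v (@rho_of R m) (v irho 0).
  exact: is_derive_coord (is_derive_id y v).
have dt : is_derive y v (@t_of R m) (v it 0).
  exact: is_derive_coord (is_derive_id y v).
set a1 := (((i == irho) && (j == it))%:R + ((i == it) && (j == irho))%:R).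
set a2 := ((i == it) && (j == it))%:R; set a4 := ((i == iu) && (j == iu))%:R.
rewrite (_ : (fun z => _) = a1 \*: @t_of R m + (2 * a2) \*: @rho_of R m
  + flat_part i j \*: (@t_of R m ^+ 2) + a4 \*: uu_coef).
  apply: is_derive_eq.
  rewrite /= -![_ *: _]/(_ * _) expr1; ring.
apply/funext => z.
rewrite -[RHS]/(a1 * t_of z + (2 * a2) * rho_of z
  + flat_part i j * (@t_of R m ^+ 2) z + a4 * uu_coef z).
by rewrite exprfctE ambient_entry -/a1 -/a2 -/a4; ring.
Qed.

Lemma partial_constant k (i : 'I_k.+1) (f : 'cV[R]_k.+1 -> R) y :
  (forall s, f (s *: delta_mx i 0 + y) = f y) -> partial i f y = 0.
Proof.
move=> fE; rewrite /partial /derive; apply: cvg_lim => //.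
rewrite (_ : (fun s => _) = cst 0); first exact: cvg_cst.
by apply/funext => s; rewrite /= fE subrr scaler0.
Qed.

Lemma uu_coef_r s y : uu_coef (s *: e ir + y) = uu_coef y.
Proof.
have tE : t_of (s *: e ir + y) = t_of y.
  by rewrite /t_of !mxE index_eq /= mulr0 add0r.
have rhoE : rho_of (s *: e ir + y) = rho_of y.
  by rewrite /rho_of !mxE index_eq /= mulr0 add0r.
have xuE : xu (s *: e ir + y) = xu y.
  apply/colP => l; rewrite !mxE [_ == ir](_ : _ = false) ?mulr0 ?add0r//.
  by rewrite -val_eqE val_i_r /= inordK; have := ltn_ord l; lia.
have psE : ambient_psum h (s *: e ir + y) = ambient_psum h y.
  by apply/funext => N; rewrite /ambient_psum /ambient_term xuE rhoE.
by rewrite /uu_coef /ambient_sum tE xuE psE.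
Qed.

End AmbientMetric.

(** * The parallel null plane *)

Section ConnectionBasis.
Context {R : realType} {k : nat}.
Local Notation point := 'cV[R]_k.+1.

(** A vector is determined by its image under the metric, so the covariant
    derivative of a coordinate field can be identified by comparing lowered
    Christoffel symbols. *)
Lemma connection_delta (g : point -> 'M[R]_k.+1) y v j (I : finType)
    (w : I -> point) (om : I -> 'I_k.+1 -> R) :
  g y \in unitmx ->
  (forall a i, lowered_christoffel g y a i j =
     \sum_b om b i * (g y *m w b) a 0) ->
  connection g y v (delta_mx j 0) = \sum_b (\sum_i om b i * v i 0) *: w b.
Proof.
move=> gU low; apply: (can_inj (mulKmx gU)); apply/colP => a.
rewrite lower_connection// mulmx_sumr summxE.
under [RHS]eq_bigr do rewrite -scalemxAr mxE mulr_suml.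
rewrite [RHS]exchange_big; apply: eq_bigr => i _.
rewrite (bigD1 j)//= [X in _ + X]big1 => [|l lj]; last first.
  by rewrite mxE (negbTE lj) mulr0.
rewrite mxE !eqxx addr0 mulr1 low mulr_suml; apply: eq_bigr => b _.
by ring.
Qed.

End ConnectionBasis.

Section AmbientHolonomy.
Context {R : realType} (m : nat) (h : 'cV[R]_m.+1 -> R).
Local Notation amb := 'cV[R]_m.+4.
Local Notation irho := (i_rho m).
Local Notation iu := (i_u m).
Local Notation ir := (i_r m).
Local Notation it := (i_t m).
Local Notation e := (fun i : 'I_m.+4 => delta_mx i 0 : amb).
Local Notation G := (ambient_metric h).
Local Notation q := (uu_coef h).
Local Notation Q := (@flat_part R m).

Lemma flat_part_rho a : Q irho a = 0.
Proof.
rewrite /flat_part !mxE summxE big1 ?index_eq ?addr0// => l _.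
by rewrite mxE (index_x_eq l l).
Qed.

Lemma flat_part_r a : Q ir a = (a == iu)%:R.
Proof.
rewrite /flat_part !mxE summxE big1 ?index_eq ?add0r ?eqxx// => l _.
by rewrite mxE (index_x_eq l l).
Qed.

Lemma flat_part_u : Q iu iu = 0.
Proof.
rewrite /flat_part !mxE summxE big1 ?index_eq ?andbF ?addr0// => l _.
by rewrite mxE (index_x_eq l l).
Qed.

Lemma flat_part_sym i j : Q i j = Q j i.
Proof.
rewrite /flat_part !mxE !summxE.
under eq_bigr do rewrite mxE andbC.
under [in RHS]eq_bigr do rewrite mxE.
by rewrite [(i == iu) && _]andbC [(i == ir) && _]andbC [X in _ + X]addrC.
Qed.

Lemma ambient_rho y a : G y irho a = t_of y * (a == it)%:R.
Proof. by rewrite ambient_entry flat_part_rho !index_eq eqxx /=; ring. Qed.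

Lemma ambient_r y a : G y ir a = t_of y ^+ 2 * (a == iu)%:R.
Proof. by rewrite ambient_entry flat_part_r !index_eq /=; ring. Qed.

Lemma ambient_uu y : G y iu iu = q y.
Proof. by rewrite ambient_entry flat_part_u !index_eq eqxx /=; ring. Qed.

Lemma ambient_sym y i j : G y i j = G y j i.
Proof. by rewrite -{1}ambient_metric_sym mxE. Qed.

Definition null_basis (b : 'I_2) : amb := if b == 0 then e irho else e ir.

Lemma ambient_null_basis y a b : (G y *m null_basis b) a 0 =
  if b == 0 then t_of y * (a == it)%:R else t_of y ^+ 2 * (a == iu)%:R.
Proof.
by rewrite /null_basis; case: ifP => _; rewrite -colE mxE ambient_sym
  ?ambient_rho ?ambient_r.
Qed.

(** The connection form of the distribution spanned by e_rho (index 0) and e_r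
    (index 1): nabla_v w_a = sum over b of (sum over i of om_abi v_i) w_b. *)
Definition null_connection (a b : 'I_2) (i : 'I_m.+4) (y : amb) : R :=
  if a == b then (i == it)%:R / t_of y
  else if a == 0 then (i == iu)%:R * partial irho q y / (2 * t_of y ^+ 2)
  else - (i == iu)%:R.

Lemma partial_ambient y k i j : differentiable q y ->
  partial k (fun z => G z i j) y =
    (k == it)%:R * (((i == irho) && (j == it))%:R + ((i == it) && (j == irho))%:R)
    + 2 * (k == irho)%:R * ((i == it) && (j == it))%:R
    + 2 * t_of y * (k == it)%:R * Q i j
    + partial k q y * ((i == iu) && (j == iu))%:R.
Proof.
move=> dq; have dqk : is_derive y (e k) q (partial k q y).
  by apply/derivableP; exact: diff_derivable.
have dG := is_derive_ambient i j dqk.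
rewrite [LHS](@derive_val _ _ _ _ _ _ _ dG); congr (_ * _ + _ * _ * _ + _ * _ * _ + _).
all: by rewrite mxE eqxx andbT eq_sym.
Qed.

(** The derivative of the metric along r vanishes, and along rho only the
    entries (t, t) and (u, u) vary; this confines the lowered derivatives of
    e_rho and e_r to the covectors dt and du, which are proportional
    to the images of e_rho and e_r under the metric. *)
Lemma connection_null_basis y v a : t_of y != 0 -> differentiable q y ->
  G y \in unitmx ->
  connection G y v (null_basis a) =
    \sum_b (\sum_i null_connection a b i y * v i 0) *: null_basis b.
Proof.
move=> t0 dq GU.
have andbM (b c : bool) : (b && c)%:R = b%:R * c%:R :> R.
  by case: b; rewrite ?mul1r ?mul0r.
have dr : partial ir q y = 0 by apply: partial_constant => s; exact: uu_coef_r.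
have [->|->] : a = ord0 \/ a = lift ord0 ord0.
  by case: a => -[|[|//]] lt2; [left|right]; exact: val_inj.
all: rewrite {1}/null_basis /=; apply: connection_delta => // c i.
all: rewrite /lowered_christoffel !partial_ambient// !big_ord_recl big_ord0.
all: rewrite !ambient_null_basis /null_connection /= ?dr.
- rewrite ![Q _ irho]flat_part_sym !flat_part_rho.
  rewrite !andbM !index_eq eqxx.
  (* Both sides are now rational in t with coefficients in q and in Kronecker
     symbols; making these opaque keeps unification from unfolding them. *)
  move: (i == it) (i == irho) (i == iu) (c == it) (c == irho) (c == iu).
  move: (partial i q y) (partial irho q y) (partial c q y) (Q i c) (t_of y) t0.
  by move=> qi qrho qc Qic t t0 b1 b2 b3 b4 b5 b6 /=; field.
- rewrite ![Q _ ir]flat_part_sym !flat_part_r.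
  rewrite !andbM !index_eq.
  move: (i == it) (i == irho) (i == iu) (c == it) (c == irho) (c == iu).
  move: (partial i q y) (partial c q y) (Q i c) (t_of y) t0.
  by move=> qi qc Qic t t0 b1 b2 b3 b4 b5 b6 /=; field.
Qed.

Definition longitudinal (a b c d : R) : amb :=
  a *: e irho + b *: e it + c *: e iu + d *: e ir.

Lemma pairing_longitudinal y a b c d a' b' c' d' :
  pairing (G y) (longitudinal a b c d) (longitudinal a' b' c' d') =
  t_of y * (a * b' + b * a') + 2 * rho_of y * (b * b')
  + t_of y ^+ 2 * (c * d' + d * c') + q y * (c * c').
Proof.
rewrite pairing_ambient big1 => [|l _]; rewrite !mxE.
  by rewrite !index_eq !eqxx /=; ring.
by rewrite !(index_x_eq l l) /=; ring.
Qed.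

Lemma pairing_longitudinal_x y a b c d l :
  pairing (G y) (longitudinal a b c d) (e (i_x l)) = 0.
Proof.
rewrite pairing_ambient big1 => [|l' _]; rewrite !mxE.
  by rewrite !(index_x_eq l l) /=; ring.
by rewrite !(index_x_eq l' l) /=; ring.
Qed.

Lemma pairing_x y l l' :
  pairing (G y) (e (i_x l)) (e (i_x l')) = t_of y ^+ 2 * (l == l')%:R.
Proof.
rewrite pairing_ambient (bigD1 l)//= big1 => [|k kl]; rewrite !mxE.
  by rewrite !(index_x_eq l l') !(index_x_eq l l) !eqxx /= ?andbT; ring.
by rewrite (index_x_eq k l) (negbTE kl) mul0r.
Qed.

(** With f = e_t / t - (rho / t^2) e_rho and k = e_u / t - (q / (2 t^3)) e_r, the
    pairs (e_rho, f) and (e_r / t, k) are null with product 1 and orthogonal to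
    each other.  The first four vectors are e_rho / 2 -+ f and e_r / (2 t) -+ k,
    ordered so that the two of square -1 come first. *)
Definition frame_vector (y : amb) (j : nat) : amb :=
  let t := t_of y in
  match j with
  | 0 => longitudinal (2^-1 + rho_of y / t ^+ 2) (- t^-1) 0 0
  | 1 => longitudinal 0 0 (- t^-1) ((1 + q y / t ^+ 2) / (2 * t))
  | 2 => longitudinal (2^-1 - rho_of y / t ^+ 2) t^-1 0 0
  | 3 => longitudinal 0 0 t^-1 ((1 - q y / t ^+ 2) / (2 * t))
  | l.+4 => t^-1 *: e (inord l.+1)
  end.

Definition ambient_frame (y : amb) : 'M[R]_m.+4 :=
  \matrix_(i, j) frame_vector y j i 0.

Lemma ambient_frameP y : t_of y != 0 -> orthonormal_frame (G y) (ambient_frame y).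
Proof.
move=> t0; apply/matrixP => i j.
have col_frame l : col l (ambient_frame y) = frame_vector y l.
  by apply/colP => a; rewrite !mxE.
have inordx (k : nat) (ltk : (k.+4 < m.+4)%N) :
    inord k.+1 = i_x (Ordinal (ltk : (k < m)%N)) by [].
rewrite -pairing_delta -pairing_mul -!colE !col_frame /eta !mxE -val_eqE.
case: i j => [[|[|[|[|i]]]] lti] [[|[|[|[|j]]]] ltj] /=.
all: rewrite ?pairing_longitudinal.
all: rewrite ?(inordx _ lti) ?(inordx _ ltj) ?pairingZr ?pairingZl.
all: rewrite 1?[pairing _ (e _) (longitudinal _ _ _ _)]pairingC ?ambient_metric_sym//.
all: rewrite ?pairing_longitudinal_x ?pairing_x ?mulr0 //.
all: try by field; rewrite t0.
Qed.

Definition null_basis_mx : 'M[R]_(m.+4, 2) := \matrix_(i, b) null_basis b i 0.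

Lemma col_null_basis b : col b null_basis_mx = null_basis b.
Proof. by apply/colP => i; rewrite !mxE. Qed.

Lemma null_basis_pairing (B : 'M[R]_m.+4) X b :
  (null_basis_mx^T *m B *m X) b 0 = pairing B (null_basis b) X.
Proof.
by rewrite -col_null_basis /pairing tr_col -!row_mul [RHS]mxE.
Qed.

Lemma null_basis_orthonormal : null_basis_mx^T *m null_basis_mx = 1%:M.
Proof.
apply/matrixP => a b.
have -> : (null_basis_mx^T *m null_basis_mx) a b =
    (null_basis_mx^T *m 1%:M *m null_basis b) a 0.
  by rewrite -col_null_basis mulmx1 colE mulmxA -colE [RHS]mxE.
have pe i j : pairing (1%:M : 'M[R]_m.+4) (e i) (e j) = (i == j)%:R.
  by rewrite pairing_delta mxE.
rewrite null_basis_pairing mxE -val_eqE /null_basis.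
by case: a b => -[|[|//]] lta [] [|[|//]] ltb /=; rewrite pe ?index_eq ?eqxx.
Qed.

Lemma null_basis_isotropic y : null_basis_mx^T *m G y *m null_basis_mx = 0.
Proof.
apply/matrixP => a b; rewrite [RHS]mxE.
have -> : (null_basis_mx^T *m G y *m null_basis_mx) a b =
    (null_basis_mx^T *m G y *m null_basis b) a 0.
  by rewrite -col_null_basis colE mulmxA -colE [RHS]mxE.
rewrite null_basis_pairing /null_basis.
by do 2!case: ifP => _; rewrite pairing_delta ?ambient_rho ?ambient_r index_eq /= ?mulr0.
Qed.

Section Domain.
Variables (U : set 'cV[R]_m.+1) (W : set amb).
Hypothesis hW : ambient_domain h U W.

Lemma domain_t_neq0 y : W y -> t_of y != 0.
Proof. by case: hW => _ tU _ _ /tU[t_gt0 _]; rewrite gt_eqF. Qed.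

Lemma domain_unit y : W y -> G y \in unitmx.
Proof.
move=> /domain_t_neq0/ambient_frameP/orthonormal_frame_unit.
by case/andP.
Qed.

Lemma domain_differentiable y i j : W y -> differentiable (fun z => G z i j) y.
Proof. by case: hW => _ _ _ smoothG; exact: (smoothG i j [::]). Qed.

Lemma uu_coefE : q = (fun z => G z iu iu).
Proof. by apply/funext => z; rewrite ambient_uu. Qed.

Lemma null_connection_continuous a b i y : W y ->
  {for y, continuous (null_connection a b i)}.
Proof.
move=> Wy; have t0 := domain_t_neq0 Wy.
have ct : {for y, continuous (@t_of R m)} by exact: coord_continuous.
have cq : {for y, continuous (partial irho q)}.
  apply: differentiable_continuous; rewrite uu_coefE.
  by case: hW => _ _ _ smoothG; exact: (smoothG iu iu [:: irho]).
have t2 : 2 * t_of y ^+ 2 != 0 by rewrite mulf_neq0 ?expf_neq0// pnatr_eq0.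
rewrite /null_connection; case: (a == b); last case: (a == 0).
- exact: (continuousM (@cst_continuous _ _ _ y) (continuousV t0 ct)).
- have ct2 : {for y, continuous (fun z : amb => 2 * t_of z ^+ 2)}.
    exact: (continuousM (@cst_continuous _ _ _ y) (continuousM ct ct)).
  have ct2V : {for y, continuous (fun z : amb => (2 * t_of z ^+ 2)^-1)}.
    exact: continuousV ct2.
  exact: (continuousM (continuousM (@cst_continuous _ _ _ y) cq) ct2V).
- exact: cst_continuous.
Qed.

Lemma holonomy_orthogonal p A (X : amb) : W p -> holonomy G W p A ->
  null_basis_mx^T *m G p *m X = 0 -> null_basis_mx^T *m G p *m (A *m X) = 0.
Proof.
move=> Wp [s [gam [gam_loop transport]]] X0.
have [Y [pY Y0 <-]] := transport X.
apply/colP => b; rewrite null_basis_pairing mxE.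
case: (gam_loop) => _ _ gam1 _; rewrite -gam1.
apply: (parallel_orthogonal (ambient_metric_sym h) domain_unit
  domain_differentiable gam_loop (w := null_basis) (om := null_connection)
  _ _ pY) => //.
- by move=> *; exact: null_connection_continuous.
- move=> y v a Wy; apply: connection_null_basis; rewrite ?domain_t_neq0 ?domain_unit//.
  by rewrite uu_coefE; exact: domain_differentiable.
- by move=> a; rewrite Y0 -null_basis_pairing X0 mxE.
- by rewrite ler01 lexx.
Qed.

End Domain.

End AmbientHolonomy.

Theorem corollary2 (R : realType) (m : nat)
    (U : set 'cV[R]_m.+1) (h : 'cV[R]_m.+1 -> R)
    (hU : open U) (hh : analytic_on U h)
    (hn : odd m.+2 \/
          exists s : nat, m.+2 = (2 * s)%N /\
            forall z : 'cV[R]_m.+1, U z -> laplacian_iter s h z = 0)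
    (W : set 'cV[R]_m.+4) (hW : ambient_domain h U W)
    (p : 'cV[R]_m.+4) (hp : W p) :
  exists (E : 'M[R]_m.+4) (N : {vspace 'cV[R]_m.+4}),
    orthonormal_frame (ambient_metric h p) E /\
    totally_null_plane N /\
    forall A : 'M[R]_m.+4, holonomy (ambient_metric h) W p A ->
      SO2_stabiliser N (invmx E *m A *m E).
Proof.
have frameE := ambient_frameP h (domain_t_neq0 hW hp).
have [N [nullN stabN]] := null_plane_stabiliser frameE
  (@null_basis_orthonormal R m) (null_basis_isotropic h p).
exists (ambient_frame h p), N; split=> //; split=> // A holA.
have sym := ambient_metric_sym h; have unitG := domain_unit hW.
have diffG := domain_differentiable hW.
apply: stabN; first exact: (holonomy_isometry sym unitG diffG hp holA).
  exact: (holonomy_det sym unitG diffG hp holA).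
by move=> X; exact: (holonomy_orthogonal hW hp holA).
Qed.
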